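(* There exists a switch-type policy of the MDP $\Delta$ that is $\Delta$-optimal.
   Context: Network model. There are $N$ users. Time is slotted, $t=0,1,2,\dots$. Arrival indicators $\Lambda_i(t)\in\{0,1\}$ are independent across users $i$ and i.i.d. over slots $t$, with $P[\Lambda_i(t)=1]=p_i$. In each slot $t$ a decision $D(t)\in\{0,1,\dots,N\}$ is made ($D(t)=0$: no update; $D(t)=i$: user $i$ is scheduled). The age of user $i$ satisfies $X_i(t+1)=1$ if $\Lambda_i(t)=1$ and $D(t)=i$, and $X_i(t+1)=X_i(t)+1$ otherwise. MDP $\Delta$. The state in slot $t$ is $\mathbf{S}(t)=(X_1(t),\dots,X_N(t),\Lambda_1(t),\dots,\Lambda_N(t))$. Let $\mathbf{X}$ be the set of all age vectors $(x_1,\dots,x_N)$ with $x_i\ge 1$ for all $i$ and $x_i\ne x_j$ for all $i\ne j$. The state space $\mathbf{S}$ consists of all $(x_1,\dots,x_N,\lambda_1,\dots,\lambda_N)$ such that $(x_1,\dots,x_N)\in\mathbf{X}$ or $x_i>N$ for all $i$, and $\lambda_i\in\{0,1\}$ for all $i$. The action in slot $t$ is $D(t)\in\{0,\dots,N\}$. From state $\mathbf{s}=(x_1,\dots,x_N,\lambda_1,\dots,\lambda_N)$ under action $d$, the next ages are $x_i'=(x_i+1)-x_i\mathbf{1}_{\{i=d,\ \lambda_i=1\}}$ and the next arrival vector $(\lambda_1',\dots,\lambda_N')$ has probability $\prod_{i:\lambda_i'=1}p_i\prod_{i:\lambda_i'=0}(1-p_i)$. The immediate cost is $C(\mathbf{s},d)=\sum_{i=1}^N(x_i+1)-x_d\lambda_d$,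 with $x_0=\lambda_0=0$. A policy $\pi$ chooses $D(t)$ for each $t$, possibly at random and depending on $D(0),\dots,D(t-1),\mathbf{S}(0),\dots,\mathbf{S}(t)$. It is deterministic stationary if $D(t)$ is a fixed (non-random) function of $\mathbf{S}(t)$. Average cost: $V(\pi)=\limsup_{T\to\infty}\frac{1}{T+1}E_\pi\left[\sum_{t=0}^T C(\mathbf{S}(t),D(t))\right]$. A policy is $\Delta$-optimal if it minimizes $V(\pi)$. Switch-type policy: a deterministic stationary policy of $\Delta$ such that, for given $\mathbf{x}_{-i}$ (the ages of the users other than $i$) and $\boldsymbol{\lambda}=(\lambda_1,\dots,\lambda_N)$, if the action at state $(x_i,\mathbf{x}_{-i},\boldsymbol{\lambda})$ is $i$, then the action at state $(x_i+1,\mathbf{x}_{-i},\boldsymbol{\lambda})$ is $i$ as well. *)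

(* Defs.v *)
From HB Require Import structures.
From mathcomp Require Import all_boot all_order all_algebra.
From mathcomp Require Import classical_sets reals ereal topology normedtype.
From mathcomp Require Import sequences.

Set Implicit Arguments.
Unset Strict Implicit.
Unset Printing Implicit Defensive.

Import Order.TTheory GRing.Theory Num.Theory.
Local Open Scope ring_scope.

Definition ages (N : nat) : Type := {ffun 'I_N -> nat}.
Definition arrivals (N : nat) : Type := {ffun 'I_N -> bool}.
Definition state (N : nat) : Type := (ages N * arrivals N)%type.

(* [None] is the decision 0 (no update); [Some i] schedules user i. *)
Definition action (N : nat) : Type := option 'I_N.

Definition positive_ages (N : nat) (x : ages N) : Prop :=
  forall i, (1 <= x i)%N.

(* The state space of the MDP.  When N >= 3 it is not closed under the
   transitions: with N = 3 and an arrival at user 1, scheduling that user takes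
   the ages (4, 4, 4) to (1, 5, 5).  The dynamics, costs and policies below are
   therefore total on [state N]; this predicate delimits the initial states. *)
Definition state_space (N : nat) (s : state N) : Prop :=
  (positive_ages s.1 /\ (forall i j, i != j -> s.1 i != s.1 j))
  \/ (forall i, (N < s.1 i)%N).

Definition next_ages (N : nat) (s : state N) (d : action N) : ages N :=
  [ffun i => ((s.1 i + 1) - s.1 i * ((d == Some i) && s.2 i))%N].

Definition cost (R : realType) (N : nat) (s : state N) (d : action N) : R :=
  \sum_(i < N) (s.1 i + 1)%:R -
  (if d is Some i then (s.1 i * s.2 i)%:R else 0).

Definition arrival_prob (R : realType) (N : nat) (p : 'I_N -> R)
    (l : arrivals N) : R :=
  (\prod_(i < N | l i) p i) * (\prod_(i < N | ~~ l i) (1 - p i)).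

(* [policy_prob pi h s d] is the probability that D(t) = d, given the past
   h = [:: (S(0), D(0)); ...; (S(t-1), D(t-1))] and the current state
   S(t) = s; the slot t is [size h]. *)
Record policy (R : realType) (N : nat) := Policy {
  policy_prob : seq (state N * action N) -> state N -> action N -> R ;
  policy_prob_ge0 : forall h s d, 0 <= policy_prob h s d ;
  policy_prob_sum1 : forall h s, \sum_(d : option 'I_N) policy_prob h s d = 1
}.

(* A sample path from S(t) = s is encoded by the sequence of the pairs
   (D(t), Lambda(t+1)), which determines all the visited states. *)
Fixpoint path_prob (R : realType) (N : nat) (p : 'I_N -> R) (pi : policy R N)
    (h : seq (state N * action N)) (s : state N)
    (w : seq (action N * arrivals N)) : R :=
  if w is (d, l) :: w' then
    policy_prob pi h s d * arrival_prob p l *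
    path_prob p pi (rcons h (s, d)) (next_ages s d, l) w'
  else 1.

Fixpoint path_cost (R : realType) (N : nat) (s : state N)
    (w : seq (action N * arrivals N)) : R :=
  if w is (d, l) :: w' then
    cost R s d + path_cost R (next_ages s d, l) w'
  else 0.

(* E_pi [ \sum_(t = 0..T) C(S(t), D(t)) | S(0) = s ].  The last component
   Lambda(T+1) of a path of length T+1 does not affect the cost. *)
Definition expected_total_cost (R : realType) (N : nat) (p : 'I_N -> R)
    (pi : policy R N) (s : state N) (T : nat) : R :=
  \sum_(w : T.+1.-tuple (option 'I_N * {ffun 'I_N -> bool})%type)
     path_prob p pi [::] s w * path_cost R s w.

Definition average_cost (R : realType) (N : nat) (p : 'I_N -> R)
    (pi : policy R N) (s : state N) : \bar R :=
  limn_esup (fun T => ((T.+1%:R)^-1 * expected_total_cost p pi s T)%:E).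

(* Minimality of the average cost among all policies, from every initial
   state. *)
Definition Delta_optimal (R : realType) (N : nat) (p : 'I_N -> R)
    (pi : policy R N) : Prop :=
  forall s : state N, state_space s ->
  forall pi' : policy R N, (average_cost p pi s <= average_cost p pi' s)%E.

Definition deterministic_stationary (R : realType) (N : nat)
    (pi : policy R N) (f : state N -> action N) : Prop :=
  forall h s d, policy_prob pi h s d = (d == f s)%:R.

Definition incr_age (N : nat) (i : 'I_N) (x : ages N) : ages N :=
  [ffun j => if j == i then (x j).+1 else x j].

(* The condition is required at all positive age vectors.  On [state_space]
   alone it would say nothing when x_i + 1 equals another age, nor at the
   states outside it that can be visited. *)
Definition switch_type (R : realType) (N : nat) (pi : policy R N) : Prop :=
  exists2 f : state N -> action N, deterministic_stationary pi f &
    forall (i : 'I_N) (x : ages N) (l : arrivals N), positive_ages x ->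
      f (x, l) = Some i -> f (incr_age i x, l) = Some i.

(* Main.v *)
Require Import Defs.
From mathcomp Require Import all_boot all_order all_algebra.
From mathcomp Require Import boolp classical_sets.
From mathcomp Require Import reals ereal normedtype sequences.
From mathcomp Require Import ring lra zify.

(* Vanishing discount.  As the arrivals are independent of the past, the value
   of the problem discounted by a, averaged over the current arrivals, is a
   function V_a of the ages alone; it is nondecreasing.  Scheduling the users
   once each leads, with a probability bounded below, from any ages x to a
   prescribed permutation r of 1, ..., N, so that V_a x <= b x + V_a r with b
   independent of a.  Hence
   h x := liminf_(a -> 1) (V_a x - V_a r) and
   g := limsup_(a -> 1) (1 - a) V_a r are finite, and they satisfy the average
   cost optimality inequality L h <= g + h, where L is the Bellman operator,
   so that the greedy policy for h has average cost at most g; by an Abelian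
   argument no policy does better.

   The greedy policy is switch-type because h is nondecreasing: an increase of
   x_i by 1 decreases by 1 the value of scheduling i relative to the common
   cost, leaves its next ages unchanged, and cannot decrease the relative value
   of the other actions.  If p_i = 0 for some i, all average costs are +oo. *)

Set Implicit Arguments.
Unset Strict Implicit.
Unset Printing Implicit Defensive.

Import Order.TTheory GRing.Theory Num.Theory.
Local Open Scope ring_scope.

(** * Dynamics of the ages *)

Section Dynamics.
Variables (R : realType) (N : nat).
Implicit Types (x y : ages N) (l : arrivals N) (s : state N) (d : action N).

Definition age_sum x : R := \sum_(i < N) (x i)%:R.

Definition add_ages x (k : nat) : ages N := [ffun j => (x j + k)%N].

Definition serve x (i : 'I_N) : ages N :=
  [ffun j => if j == i then 1%N else (x j).+1].

Definition le_ages x y := forall i, (x i <= y i)%N.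

Lemma age_sum_ge0 x : 0 <= age_sum x.
Proof. by apply: sumr_ge0 => i _; exact: ler0n. Qed.

Lemma age_sum_le x y : le_ages x y -> age_sum x <= age_sum y.
Proof. by move=> xy; apply: ler_sum => i _; rewrite ler_nat. Qed.

Lemma age_sum_add x k : age_sum (add_ages x k) = age_sum x + N%:R * k%:R.
Proof.
rewrite /age_sum (eq_bigr (fun i => (x i)%:R + k%:R)) => [|i _].
  by rewrite big_split /= sumr_const card_ord mulr_natl.
by rewrite ffunE natrD.
Qed.

Lemma costE s d : cost R s d =
  age_sum s.1 + N%:R - (if d is Some i then (s.1 i * s.2 i)%:R else 0).
Proof.
congr (_ - _); rewrite (eq_bigr (fun i => (s.1 i)%:R + 1)) => [|i _].
  by rewrite big_split /= sumr_const card_ord.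
by rewrite natrD.
Qed.

Lemma cost_le s d : cost R s d <= age_sum s.1 + N%:R.
Proof. by rewrite costE gerBl; case: d. Qed.

Lemma le_cost x y l d : le_ages x y -> cost R (x, l) d <= cost R (y, l) d.
Proof.
move=> xy; rewrite !costE /=; case: d => [i|]; last first.
  by rewrite !subr0 lerD2r age_sum_le.
rewrite /age_sum (bigD1 i) //= [in leRHS](bigD1 i) //=.
have h : \sum_(j < N | j != i) (x j)%:R <= \sum_(j < N | j != i) (y j)%:R :> R.
  by apply: ler_sum => j _; rewrite ler_nat.
have h' : (x i)%:R <= (y i)%:R :> R by rewrite ler_nat.
by case: (l i); rewrite ?muln1 ?muln0 ?mulr0n ?subr0; lra.
Qed.

Lemma cost_ge0 s d : 0 <= cost R s d.
Proof.
rewrite /cost subr_ge0; case: d => [i|].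
  rewrite (bigD1 i) //= natrD.
  have : 0 <= \sum_(j < N | j != i) (s.1 j + 1)%:R :> R.
    by apply: sumr_ge0 => j _; exact: ler0n.
  have : 0 <= (s.1 i)%:R :> R by exact: ler0n.
  by case: (s.2 i); rewrite ?muln1 ?muln0 ?mulr0n; lra.
by apply: sumr_ge0 => j _; exact: ler0n.
Qed.

Lemma next_agesE x l d : next_ages (x, l) d =
  if d is Some i then if l i then serve x i else add_ages x 1
  else add_ages x 1.
Proof.
apply/ffunP => j; rewrite !ffunE /=; case: d => [i|]; last first.
  by rewrite !ffunE /= muln0 subn0.
rewrite eq_sym (_ : (Some j == Some i) = (j == i)) //.
have [->|ji] := eqVneq j i.
  case: ifP => li; rewrite !ffunE ?eqxx /= ?muln1 ?muln0 ?subn0 //.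
  by rewrite addKn.
rewrite muln0 subn0; case: ifP => _; rewrite !ffunE ?(negbTE ji) //.
by rewrite addn1.
Qed.

Lemma le_next_ages x y l d :
  le_ages x y -> le_ages (next_ages (x, l) d) (next_ages (y, l) d).
Proof.
move=> xy j; rewrite !next_agesE.
case: d => [i|]; last by rewrite !ffunE leq_add2r.
case: ifP => _; rewrite !ffunE ?leq_add2r //.
by case: ifP => // _; rewrite ltnS.
Qed.

(* Age vectors dominating a permutation of 1, ..., N: this is a set closed
   under the transitions which contains the ages of all states of
   [state_space]. *)
Definition base_ages x := injective x /\ forall i, (0 < x i <= N)%N.

Definition dominating x := exists2 r, base_ages r & le_ages r x.

Definition base0 : ages N := [ffun i : 'I_N => i.+1].

Lemma base_ages0 : base_ages base0.
Proof.
split=> [i j|i]; first by rewrite !ffunE => -[] /val_inj.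
by rewrite ffunE ltn_ord.
Qed.

(** Idling keeps the permutation [r]. Serving [i] cycles it: [i] drops to 1 and the entries below
    [r i] move up by one, which the growth of the ages covers. *)
Lemma dominating_next x l d : dominating x -> dominating (next_ages (x, l) d).
Proof.
move=> [r [rI rB] rx].
have D1 : dominating (add_ages x 1).
  by exists r => // i; rewrite ffunE (leq_trans (rx i)) ?leq_addr.
rewrite next_agesE; case: d => [i|] //; case: ifP => // _.
pose r' : ages N := [ffun j =>
  if j == i then 1%N else if (r j < r i)%N then (r j).+1 else r j].
exists r'.
  have ne k : k != i -> r k != r i by apply: contraNneq => /rI ->.
  split=> [j k|j]; rewrite !ffunE.
    have [->|ji] := eqVneq j i; have [->|ki] := eqVneq k i => //.
    - move=> e; have := ne _ ki; have := rB k; have := rB i; move: e.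
      by move: (r k) (r i) => a b; case: (ltnP a b); lia.
    - move=> e; have := ne _ ji; have := rB j; have := rB i; move: e.
      by move: (r j) (r i) => a b; case: (ltnP a b); lia.
    - move=> e; apply: rI; have := ne _ ji; have := ne _ ki; move: e.
      move: (r j) (r k) (r i) => a b c.
      by case: (ltnP a c); case: (ltnP b c); lia.
  have /andP[ri0 riN] := rB i; have /andP[rj0 rjN] := rB j.
  case: eqP => _; first by rewrite (leq_trans ri0 riN).
  by case: (ltnP (r j) (r i)); lia.
move=> j; rewrite !ffunE; case: ifP => // _.
by have := rx j; case: (ltnP (r j) (r i)); lia.
Qed.

Lemma dominating_state_space s : state_space s -> dominating s.1.
Proof.
case: s => x l [/= [x0 xI]|/= xN]; last first.
  exists base0; first exact: base_ages0.
  by move=> i; rewrite ffunE; apply: leq_ltn_trans (xN i); exact: ltnW.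
(* The rank of [x i] is at most [x i], as the ages not exceeding it are distinct and positive. *)
pose r : ages N := [ffun i => #|[pred j | (x j <= x i)%N]|].
have mono i j : (x i < x j)%N -> (r i < r j)%N.
  move=> ij; rewrite !ffunE; apply: proper_card; apply/properP; split.
    by apply/fintype.subsetP => k; rewrite !inE => /leq_trans; apply; exact: ltnW.
  by exists j; rewrite inE // -ltnNge.
exists r; last first.
  move=> i; rewrite ffunE.
  rewrite -[leqRHS](size_iota 1) cardE.
  rewrite -(size_map x); apply: uniq_leq_size.
    rewrite map_inj_uniq ?enum_uniq // => j k e.
    by apply: contra_eq e; exact: xI.
  move=> k /mapP[j]; rewrite mem_enum inE => ji ->.
  by rewrite mem_iota add1n ltnS ji x0.
split=> [i j rij|i].
  apply/eqP; apply: contraT => /xI; rewrite neq_ltn.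
  by case/orP => /mono; rewrite rij ltnn.
rewrite ffunE; apply/andP; split.
  by apply/card_gt0P; exists i; rewrite inE.
by rewrite -[leqRHS]card_ord max_card.
Qed.

End Dynamics.

(** * The law of the arrival vector *)

Section Arrivals.
Variables (R : realType) (N : nat) (p : 'I_N -> R).
Hypothesis p01 : forall i, 0 <= p i <= 1.

Lemma arrival_probE (l : arrivals N) :
  arrival_prob p l = \prod_i (if l i then p i else 1 - p i).
Proof.
rewrite (bigID (fun i => l i)) /=; congr (_ * _).
  by apply: eq_bigr => i ->.
by apply: eq_bigr => i; case: (l i).
Qed.

Lemma arrival_prob_ge0 l : 0 <= arrival_prob p l.
Proof.
rewrite arrival_probE; apply: prodr_ge0 => i _.
by have := p01 i; case: ifP => _; lra.
Qed.

Lemma arrival_expect (i : 'I_N) (F : bool -> R) :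
  \sum_(l : {ffun 'I_N -> bool}) arrival_prob p l * F (l i) =
  p i * F true + (1 - p i) * F false.
Proof.
pose G j (b : bool) := (if b then p j else 1 - p j) * (if j == i then F b else 1).
transitivity (\prod_j \sum_b G j b).
  rewrite bigA_distr_bigA; apply: eq_bigr => l _.
  rewrite arrival_probE /G big_split /=; congr (_ * _).
  by rewrite -big_mkcond big_pred1_eq.
rewrite (bigD1 i) //= [X in _ * X]big1 => [|j /negbTE ji].
  by rewrite mulr1 big_bool /G eqxx.
by rewrite big_bool /G ji /=; ring.
Qed.

Lemma arrival_prob_sum : \sum_(l : {ffun 'I_N -> bool}) arrival_prob p l = 1.
Proof.
under eq_bigr do rewrite arrival_probE.
rewrite -(bigA_distr_bigA (fun i (b : bool) => if b then p i else 1 - p i)) /=.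
by rewrite big1 // => i _; rewrite big_bool /=; ring.
Qed.

Lemma arrival_sum_const (c : R) :
  \sum_(l : {ffun 'I_N -> bool}) arrival_prob p l * c = c.
Proof. by rewrite -mulr_suml arrival_prob_sum mul1r. Qed.

Lemma arrival_sum_le (F G : arrivals N -> R) : (forall l, F l <= G l) ->
  \sum_(l : {ffun 'I_N -> bool}) arrival_prob p l * F l <=
  \sum_(l : {ffun 'I_N -> bool}) arrival_prob p l * G l.
Proof.
by move=> FG; apply: ler_sum => l _; rewrite ler_wpM2l ?arrival_prob_ge0.
Qed.

End Arrivals.

(** * Bellman operator and greedy actions *)

Section Bellman.
Variables (R : realType) (N : nat) (p : 'I_N -> R).
Hypothesis p01 : forall i, 0 <= p i <= 1.
Implicit Types (u v : ages N -> R) (x y : ages N) (l : arrivals N).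
Implicit Types (s : state N) (d : action N).

Definition monotone_ages u := forall x y, le_ages x y -> u x <= u y.

Definition action_value u s d : R := cost R s d + u (next_ages s d).

Definition admissible s d : bool := if d is Some i then s.2 i else true.

(* Scheduling a user without arrival has the same effect as idling, and the
   switch property would fail if ties were resolved in its favour: the minimum
   is taken over the other actions only. *)
Definition greedy u s : action N :=
  [arg min_(d < None | admissible s d) action_value u s d]%O.

Definition state_bellman u s : R := action_value u s (greedy u s).

Definition bellman u x : R :=
  \sum_(l : {ffun 'I_N -> bool}) arrival_prob p l * state_bellman u (x, l).

Lemma inadmissible_value u s d :
  ~~ admissible s d -> action_value u s d = action_value u s None.
Proof.
case: s => x l; case: d => [i|] //= /negbTE li.
by rewrite /action_value !costE !next_agesE /= li muln0.
Qed.

Lemma admissible_greedy u s : admissible s (greedy u s).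
Proof. by rewrite /greedy; case: arg_minP. Qed.

Lemma state_bellman_le u s d : state_bellman u s <= action_value u s d.
Proof.
rewrite /state_bellman /greedy; case: arg_minP => // d' _ min.
have [ad|nad] := boolP (admissible s d); first exact: min.
by rewrite (inadmissible_value _ nad); exact: min.
Qed.

(** Admissibility forces an arrival at [i], so the value of scheduling [i] is the same at both
    states, while that of any other action grows by at least 1. The gap is strict, so the choice
    among ties is immaterial. *)
Lemma greedy_switch u (i : 'I_N) x l : monotone_ages u ->
  greedy u (x, l) = Some i -> greedy u (incr_age i x, l) = Some i.
Proof.
move=> um gi; have li : l i by have := admissible_greedy u (x, l); rewrite gi.
set x' := incr_age i x; apply/eqP; apply/negPn/negP => ne.
have xx' : le_ages x x' by move=> j; rewrite ffunE; case: ifP.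
have ad : admissible (x', l) (greedy u (x', l)) by exact: admissible_greedy.
have h1 : action_value u (x', l) (greedy u (x', l)) <=
    action_value u (x', l) (Some i) by exact: state_bellman_le.
have h2 : action_value u (x, l) (Some i) <=
    action_value u (x, l) (greedy u (x', l)).
  by rewrite -gi; exact: state_bellman_le.
move: (greedy u (x', l)) ne ad h1 h2 => d ne ad.
have sx : age_sum R x' = age_sum R x + 1.
  rewrite /age_sum (bigD1 i) //= [in RHS](bigD1 i) //= ffunE eqxx -natr1.
  rewrite addrAC; congr (_ + _ + 1); apply: eq_bigr => j /negbTE ji.
  by rewrite ffunE ji.
have ni : next_ages (x', l) (Some i) = next_ages (x, l) (Some i).
  rewrite !next_agesE li; apply/ffunP => j; rewrite !ffunE.
  by case: eqP.
have nd : u (next_ages (x, l) d) <= u (next_ages (x', l) d).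
  exact/um/le_next_ages.
rewrite /action_value ni !costE /= sx.
have x'i : x' i = (x i).+1 by rewrite ffunE eqxx.
rewrite x'i li !muln1 -natr1.
case: d ne ad nd => [j|] ne ad nd; last by lra.
have x'j : x' j = x j.
  by rewrite ffunE; case: (eqVneq j i) ne => // ->; rewrite eqxx.
by rewrite x'j; lra.
Qed.

Lemma bellman_le_action u x d : bellman u x <=
  \sum_(l : {ffun 'I_N -> bool}) arrival_prob p l * action_value u (x, l) d.
Proof. by apply: arrival_sum_le => // l; exact: state_bellman_le. Qed.

Lemma state_bellman_mono_fun u v s : (forall y, u y <= v y) ->
  state_bellman u s <= state_bellman v s.
Proof.
move=> uv; apply: le_trans (state_bellman_le _ _ (greedy v s)) _.
by rewrite lerD2l uv.
Qed.

Lemma bellman_mono_fun u v x : (forall y, u y <= v y) ->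
  bellman u x <= bellman v x.
Proof. by move=> uv; apply: arrival_sum_le => // l; exact: state_bellman_mono_fun. Qed.

Lemma bellman_mono u : monotone_ages u -> monotone_ages (bellman u).
Proof.
move=> um x y xy; apply: arrival_sum_le => // l.
apply: le_trans (state_bellman_le _ _ (greedy u (y, l))) _.
by apply: lerD; [exact: le_cost|exact/um/le_next_ages].
Qed.

Lemma bellman_ge0 u x : (forall y, 0 <= u y) -> 0 <= bellman u x.
Proof.
move=> u0; apply: sumr_ge0 => l _; rewrite mulr_ge0 ?arrival_prob_ge0 //.
by rewrite addr_ge0 ?cost_ge0.
Qed.

Lemma bellman_addC u (c : R) x : bellman u x + c <= bellman (fun y => u y + c) x.
Proof.
rewrite -[c in _ + c](arrival_sum_const p) -big_split /=.
under eq_bigr do rewrite -mulrDr.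
apply: arrival_sum_le => // l.
by rewrite /state_bellman /action_value addrA lerD2r; exact: state_bellman_le.
Qed.

Local Open Scope classical_set_scope.

(** A Fatou-type inequality. Only finitely many ages can follow [x], so the bounds hold jointly for
    large [k]; the greedy action for [u_ k] is then a competitor for [u]. *)
Lemma bellman_liminf (u_ : nat -> ages N -> R) u x (e : R) :
  (forall l d, \forall k \near \oo,
    u (next_ages (x, l) d) - e <= u_ k (next_ages (x, l) d)) ->
  \forall k \near \oo, bellman u x - e <= bellman (u_ k) x.
Proof.
move=> H.
have : \forall k \near \oo, forall ld : {ffun 'I_N -> bool} * option 'I_N,
    u (next_ages (x, ld.1) ld.2) - e <= u_ k (next_ages (x, ld.1) ld.2).
  by apply: filter_forall => -[l d]; exact: H.
apply: filterS => k Hk.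
rewrite -[e](arrival_sum_const p) -sumrB.
under eq_bigr do rewrite -mulrBr.
apply: arrival_sum_le => // l; rewrite lerBlDr.
apply: le_trans (state_bellman_le _ _ (greedy (u_ k) (x, l))) _.
rewrite /state_bellman /action_value -lerBlDr -addrA. rewrite lerD2l.
exact: Hk (l, _).
Qed.

End Bellman.

(** * Finite-horizon discounted values *)

Section DiscountedValue.
Variables (R : realType) (N : nat) (p : 'I_N -> R).
Hypothesis p01 : forall i, 0 <= p i <= 1.
Implicit Types (a : R) (x y r : ages N).

Fixpoint value a n x : R :=
  if n is n'.+1 then bellman p (fun y => a * value a n' y) x else 0.

Lemma value_ge0 a n x : 0 <= a -> 0 <= value a n x.
Proof.
by move=> a0; elim: n x => [|n IH] x //=; apply: bellman_ge0 => // y; rewrite mulr_ge0.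
Qed.

Lemma value_mono a n : 0 <= a -> monotone_ages (value a n).
Proof.
move=> a0; elim: n => [|n IH] x y xy //=.
by apply: bellman_mono => // x' y' xy'; rewrite ler_wpM2l // IH.
Qed.

Lemma value_incr1 a n x : 0 <= a -> value a n x <= value a n.+1 x.
Proof.
move=> a0; elim: n x => [|n IH] x; first exact: value_ge0.
by apply: bellman_mono_fun => // y; rewrite ler_wpM2l.
Qed.

Lemma value_incr a m n x : 0 <= a -> (m <= n)%N -> value a m x <= value a n x.
Proof.
move=> a0; elim: n => [|n IH]; first by rewrite leqn0 => /eqP ->.
rewrite leq_eqVlt => /predU1P[->//|/IH/le_trans]; apply; exact: value_incr1.
Qed.

Lemma value_idle a n x : 0 <= a ->
  value a n.+1 x <= age_sum R x + N%:R + a * value a n (add_ages x 1).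
Proof.
move=> a0; apply: le_trans (bellman_le_action p01 _ _ None) _.
rewrite -[leRHS](arrival_sum_const p); apply: arrival_sum_le => // l.
by rewrite /action_value next_agesE lerD2r cost_le.
Qed.

Lemma value_idle1 a n x : 0 <= a <= 1 ->
  value a n.+1 x <= age_sum R x + N%:R + value a n (add_ages x 1).
Proof.
move=> /andP[a0 a1]; apply: le_trans (value_idle _ _ a0) _.
by rewrite lerD2l ler_piMl ?value_ge0.
Qed.

(** Being served leaves smaller ages than waiting, so understating the success probability only
    weakens the bound; a single [q] can then serve all users. *)
Lemma value_serve a (q : R) n x i : 0 <= a <= 1 -> q <= p i ->
  value a n.+1 x <= age_sum R x + N%:R +
    (q * value a n (serve x i) + (1 - q) * value a n (add_ages x 1)).
Proof.
move=> /andP[a0 a1] qp; apply: le_trans (bellman_le_action p01 _ _ (Some i)) _.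
pose F (b : bool) := age_sum R x + N%:R +
  value a n (if b then serve x i else add_ages x 1).
apply: (@le_trans _ _ (\sum_(l : {ffun 'I_N -> bool}) arrival_prob p l * F (l i))).
  apply: arrival_sum_le => // l.
  rewrite /action_value next_agesE /F; apply: lerD; first exact: cost_le.
  by rewrite ler_piMl ?value_ge0.
rewrite arrival_expect // /F.
have : value a n (serve x i) <= value a n (add_ages x 1).
  by apply: value_mono => // j; rewrite !ffunE addn1; case: ifP.
have := p01 i; move: (value _ _ _) (value _ _ _) (age_sum R x + _) => v w c.
move=> _ vw; rewrite -subr_ge0.
rewrite (_ : _ - _ = (p i - q) * (v - w)); first by rewrite mulr_ge0 ?subr_ge0 //.
by ring.
Qed.

(* The ages after k of N.+1 slots in which the users are scheduled once each, in
   decreasing order of their target age r, if all attempts so far succeeded: the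
   first slot is idle, and after the last one the ages are exactly r. *)
Definition sweep r x k : ages N :=
  [ffun j => if (N.+1 - k < r j)%N then (r j - (N.+1 - k))%N else (x j + k)%N].

Lemma sweep_le r x k : base_ages r -> (k <= N.+1)%N ->
  le_ages (sweep r x k) (add_ages x k).
Proof.
move=> [_ rB] kN j; rewrite !ffunE; have /andP[r0 rN] := rB j.
by case: ltnP => //; lia.
Qed.

(** The user served in slot [k] has target age N+1-k: its age is 1 after that slot and reaches the
    target after slot N. For k = 0 no target matches. *)
Lemma sweepS r x k : base_ages r -> (k <= N)%N ->
  sweep r x k.+1 = add_ages (sweep r x k) 1 \/
  exists i, sweep r x k.+1 = serve (sweep r x k) i.
Proof.
move=> [rI rB] kN.
have [/existsP[i /eqP ri]|] := boolP [exists i, r i == (N.+1 - k)%N].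
  right; exists i; apply/ffunP => j; rewrite !ffunE.
  have [->|ji] := eqVneq j i; first by rewrite ri; case: ifP; lia.
  have : r j <> (N.+1 - k)%N by rewrite -ri => /rI; exact/eqP.
  by do 2?case: ifP; lia.
rewrite negb_exists => /forallP H; left; apply/ffunP => j; rewrite !ffunE.
by have := H j; do 2?case: ifP; lia.
Qed.

(** All attempts succeed with weight [q ^+ k]; after a failure the ages are bounded by those of pure
    idling. The bracket bounds the cost of each slot, as no age grows by more than N+1. *)
Lemma value_sweep a (q : R) r x n k : 0 <= a <= 1 -> 0 <= q <= 1 ->
  (forall i, q <= p i) -> base_ages r -> (k <= N.+1)%N ->
  value a (n + k) x <=
    k%:R * (age_sum R x + N%:R * N.+1%:R + N%:R) +
    (q ^+ k * value a n (sweep r x k) +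
     (1 - q ^+ k) * value a n (add_ages x k)).
Proof.
move=> a01 q01 qp rB; have /andP[a0 a1] := a01; have /andP[q0 q1] := q01.
elim: k n => [|k IH] n kN.
  rewrite expr0 mul0r add0r mul1r subrr mul0r addr0 addn0.
  apply: value_mono => // j; rewrite ffunE subn0 addn0; case: ltnP => //.
  by have [_ /(_ j)] := rB; lia.
set C := age_sum R x + _ + _.
have kN' : (k <= N)%N by [].
have costC y : le_ages y (add_ages x k) -> age_sum R y + N%:R <= C.
  move=> yx; rewrite lerD2r; apply: le_trans (age_sum_le R yx) _.
  rewrite age_sum_add lerD2l ler_wpM2l ?ler0n // ler_nat; exact: leqW.
have addS : add_ages (add_ages x k) 1 = add_ages x k.+1.
  by apply/ffunP => j; rewrite !ffunE addn1 addnS.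
have slow : value a n.+1 (add_ages x k) <= C + value a n (add_ages x k.+1).
  by apply: le_trans (value_idle1 _ _ a01) _; rewrite addS lerD2r costC.
have sw := sweep_le x rB (leqW kN').
have fast : value a n.+1 (sweep r x k) <= C +
    (q * value a n (sweep r x k.+1) + (1 - q) * value a n (add_ages x k.+1)).
  have mono : value a n (add_ages (sweep r x k) 1) <= value a n (add_ages x k.+1).
    by apply: value_mono => // j; rewrite -addS !ffunE leq_add2r; have := sw j; rewrite !ffunE.
  have C1 := costC _ sw.
  (* An idle slot involves no attempt, but giving weight 1 - q to the larger ages is still an upper
     bound. *)
  have [->|[i ->]] := sweepS x rB kN'.
    apply: le_trans (value_idle1 _ _ a01) _; apply: lerD => //.
    rewrite -subr_ge0 (_ : _ - _ = (1 - q) *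
      (value a n (add_ages x k.+1) - value a n (add_ages (sweep r x k) 1))).
      by rewrite mulr_ge0 ?subr_ge0 //.
    by ring.
  apply: le_trans (value_serve _ _ a01 (qp i)) _; apply: lerD => //.
  by rewrite lerD2l ler_wpM2l ?subr_ge0 //.
rewrite addnS -addSn; apply: le_trans (IH n.+1 (leqW kN')) _.
have qk0 : 0 <= q ^+ k by rewrite exprn_ge0.
have qk1 : 0 <= 1 - q ^+ k by rewrite subr_ge0 exprn_ile1.
have := ler_wpM2l qk0 fast; have := ler_wpM2l qk1 slow.
rewrite -/C -(natr1 k) exprS.
set A := value a n.+1 (sweep r x k); set B := value a n.+1 (add_ages x k).
set D := value a n (add_ages x k.+1); set E := value a n (sweep r x k.+1).
move: A B D E (q ^+ k) => A B D E t h1 h2.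
apply: (@le_trans _ _ (k%:R * C + (t * (C + (q * E + (1 - q) * D)) +
  (1 - t) * (C + D)))); first by rewrite lerD2l lerD.
by rewrite le_eqVlt; apply/orP; left; apply/eqP; ring.
Qed.

(** A sweep reaches [r] with weight [q], and otherwise is restarted from ages increased by N+1.
    Accumulating the costs until success suggests a [b] affine in the age sum. *)
Lemma value_bounded : (forall i, 0 < p i) ->
  exists b : ages N -> R, forall a n x r, 0 <= a <= 1 -> base_ages r ->
    value a n x <= b x + value a n r.
Proof.
move=> p0; pose rho := \prod_i p i.
have rho0 : 0 < rho by apply: prodr_gt0.
have rho1 : rho <= 1 by apply: prodr_ile1 => i _; exact: p01.
have rhop i : rho <= p i.
  rewrite /rho (bigD1 i) //= ler_piMr //; first by have := p01 i; lra.
  by apply: prodr_ile1 => j _; exact: p01.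
pose q := rho ^+ N.+1; have q0 : 0 < q by rewrite exprn_gt0.
have q1 : q <= 1 by rewrite exprn_ile1 // ltW.
(* With b = c S + c', where S is the age sum, the induction needs M (S + N M + N) + (1 - q) (c (S +
   N M) + c') <= c S + c'. The coefficient of S gives [c]; the constant terms give [c'] once - q c N
   M is dropped. *)
pose M : R := N.+1%:R; pose c := M / q.
pose c' := (M * (N%:R * M + N%:R) + c * (N%:R * M)) / q.
have M0 : 0 <= M by exact: ler0n.
have N0 : 0 <= N%:R :> R by exact: ler0n.
have c0 : 0 <= c by rewrite divr_ge0 // ltW.
have c'0 : 0 <= c'.
  apply: divr_ge0 (ltW q0); have NM := mulr_ge0 N0 M0.
  exact: addr_ge0 (mulr_ge0 M0 (addr_ge0 NM N0)) (mulr_ge0 c0 NM).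
exists (fun x => c * age_sum R x + c') => a n x r a01 rB.
have /andP[a0 _] := a01.
elim: n x => [|n IH] x.
  by rewrite /= addr0 addr_ge0 // mulr_ge0 // age_sum_ge0.
(* The horizon is extended so that [n] slots remain after the sweep; the induction hypothesis then
   covers the failures. *)
apply: (@le_trans _ _ (value a (n + N.+1) x)).
  by apply: value_incr => //; rewrite addnS ltnS leq_addr.
apply: le_trans (value_sweep x n a01 _ rhop rB (leqnn _)) _.
  by rewrite rho1 ltW.
have -> : sweep r x N.+1 = r.
  by apply/ffunP => j; rewrite ffunE subnn subn0; have [_ /(_ j)/andP[->]] := rB.
rewrite -/q -/M; have := IH (add_ages x N.+1); rewrite age_sum_add -/M.
have := value_incr1 n r a0.
set v := value a n r; set v' := value a n.+1 r; set w := value a n (add_ages x N.+1).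
move: v v' w (age_sum R x) => v v' w S vv'.
have q1' : 0 <= 1 - q by rewrite subr_ge0.
move=> /(ler_wpM2l q1') h.
have e1 : q * c = M by rewrite mulrC divfK ?gt_eqF.
have e2 : q * c' = M * (N%:R * M + N%:R) + c * (N%:R * M).
  by rewrite mulrC divfK ?gt_eqF.
have e3 := mulr_ge0 (ltW q0) (mulr_ge0 c0 (mulr_ge0 N0 M0)).
have : (1 - q) * (c * (S + N%:R * M) + c' + v) =
   c * S - (q * c) * S + c * (N%:R * M) - q * (c * (N%:R * M)) + c' - q * c' + v - q * v.
  by ring.
rewrite e1 e2 => e4; rewrite e4 in h.
have -> : M * (S + N%:R * M + N%:R) = M * S + M * (N%:R * M + N%:R) by ring.
lra.
Qed.

End DiscountedValue.

(** * The average cost optimality inequality *)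

Section LowerLimit.
Variable R : realType.
Implicit Types (u : nat -> R) (c e y lo hi : R).
Local Open Scope classical_set_scope.

(** The limit inferior as a real number, meaningful for bounded sequences; hence the bounds [lo] and
    [hi] below. *)
Definition lower_limit u : R := sup [set y | \forall k \near \oo, y <= u k].

Lemma lower_limit_has_sup u lo hi : (forall k, lo <= u k <= hi) ->
  has_sup [set y | \forall k \near \oo, y <= u k].
Proof.
move=> uB; split.
  by exists lo; apply: nearW => k; have /andP[] := uB k.
exists hi => y /filter_ex[k] /le_trans; apply.
by have /andP[] := uB k.
Qed.

Lemma le_lower_limit u lo hi y : (forall k, lo <= u k <= hi) ->
  (\forall k \near \oo, y <= u k) -> y <= lower_limit u.
Proof. by move=> /lower_limit_has_sup/sup_upper_bound; apply. Qed.

Lemma lower_limit_near u lo hi e : (forall k, lo <= u k <= hi) -> 0 < e ->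
  \forall k \near \oo, lower_limit u - e <= u k.
Proof.
move=> /lower_limit_has_sup us e0; have [y yu yl] := sup_adherent e0 us.
by apply: filterS yu => k; apply: le_trans; exact: ltW.
Qed.

Lemma lower_limit_mono u v lo hi : (forall k, lo <= u k <= hi) ->
  (forall k, lo <= v k <= hi) -> (forall k, u k <= v k) ->
  lower_limit u <= lower_limit v.
Proof.
move=> uB vB uv; apply/ler_addgt0Pr => e e0; rewrite -lerBlDr.
apply: le_lower_limit vB _.
by apply: filterS (lower_limit_near uB e0) => k /le_trans; apply.
Qed.

Lemma near_harmonic_small c e : 0 < e ->
  \forall k \near \oo, k.+1%:R^-1 * c <= e.
Proof.
move=> e0; have c1 : 0 < `|c| + 1 by rewrite ltr_wpDl.
have e1 : 0 < e / (`|c| + 1) by rewrite divr_gt0.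
apply: filterS (near_infty_natSinv_lt (PosNum e1)) => k /= /ltW h.
have k0 : 0 <= k.+1%:R^-1 :> R by rewrite invr_ge0 ler0n.
apply: le_trans (ler_wpM2l k0 (ler_norm c)) _.
apply: le_trans (ler_wpM2r (normr_ge0 c) h) _.
rewrite -mulrA ler_piMr ?(ltW e0) // mulrC ler_pdivrMr // mul1r.
by rewrite lerDl.
Qed.

End LowerLimit.

(** * The vanishing-discount limit *)

Section AverageOptimality.
Variables (R : realType) (N : nat) (p : 'I_N -> R).
Hypothesis p01 : forall i, 0 <= p i <= 1.
Variable b : ages N -> R.
Hypothesis value_le_b : forall a n x r, 0 <= a <= 1 -> base_ages r ->
  value p a n x <= b x + value p a n r.
Implicit Types (a : R) (x y r : ages N).
Local Open Scope classical_set_scope.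

Let z := base0 N.
Let zB := base_ages0 N.

Lemma bound_ge0 x : 0 <= b x.
Proof.
by have := @value_le_b 0 0 x z; rewrite lexx ler01 addr0; apply.
Qed.

Let growth := age_sum R z + N%:R + b (add_ages z 1).

Lemma growth_ge0 : 0 <= growth.
Proof. by rewrite !addr_ge0 ?age_sum_ge0 ?bound_ge0 ?ler0n. Qed.

(** Idling once from [z] and comparing the resulting ages with [z] gives v' <= growth + a v for
    consecutive horizons; growth / (1 - a) is the fixed point. *)
Lemma value_growth a n : 0 <= a < 1 -> (1 - a) * value p a n z <= growth.
Proof.
move=> /andP[a0 a1]; have a01 : 0 <= a <= 1 by rewrite a0 ltW.
have b1 : 0 < 1 - a by rewrite subr_gt0.
rewrite mulrC -ler_pdivlMr //; elim: n => [|n IH].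
  by rewrite divr_ge0 ?growth_ge0 ?ltW.
apply: le_trans (value_idle p01 _ _ a0) _.
apply: le_trans (_ : growth + a * (growth / (1 - a)) <= _); last first.
  rewrite le_eqVlt; apply/orP; left; apply/eqP; field.
  by rewrite gt_eqF.
rewrite /growth -addrA -[in leRHS]addrA -[in leRHS]addrA !lerD2l -/growth.
apply: le_trans (ler_wpM2l a0 (value_le_b n (add_ages z 1) a01 zB)) _.
rewrite mulrDr lerD //; first by rewrite ler_piMl ?bound_ge0 // ltW.
by rewrite ler_wpM2l.
Qed.

Definition discounted_value a x : R := sup (range (fun n => value p a n x)).

Lemma discounted_value_has_sup a x : 0 <= a < 1 ->
  has_sup (range (fun n => value p a n x)).
Proof.
move=> a01; have /andP[a0 a1] := a01; split; first by exists (value p a 0 x), 0%N.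
exists (b x + growth / (1 - a)) => _ [n _ <-].
apply: le_trans (value_le_b n x _ zB) _; first by rewrite a0 ltW.
by rewrite lerD2l ler_pdivlMr ?subr_gt0 // mulrC value_growth.
Qed.

Lemma value_le_discounted a n x : 0 <= a < 1 ->
  value p a n x <= discounted_value a x.
Proof.
by move=> /discounted_value_has_sup h; apply: (sup_upper_bound (h x)); exists n.
Qed.

Lemma discounted_value_le a x c : (forall n, value p a n x <= c) ->
  discounted_value a x <= c.
Proof.
by move=> h; apply: ge_sup => [|_ [n _ <-]//]; exists (value p a 0 x), 0%N.
Qed.

Lemma discounted_value_ge0 a x : 0 <= a < 1 -> 0 <= discounted_value a x.
Proof. by move=> a01; exact: (value_le_discounted 0 x a01). Qed.

Lemma discounted_value_mono a : 0 <= a < 1 -> monotone_ages (discounted_value a).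
Proof.
move=> a01 x y xy; apply: discounted_value_le => n.
have /andP[a0 _] := a01.
exact: le_trans (value_mono p01 n a0 xy) (value_le_discounted n y a01).
Qed.

Lemma discounted_value_bound a x r : 0 <= a < 1 -> base_ages r ->
  discounted_value a x <= b x + discounted_value a r.
Proof.
move=> a01 rB; apply: discounted_value_le => n; have /andP[a0 a1] := a01.
apply: le_trans (value_le_b n x _ rB) _; first by rewrite a0 ltW.
by rewrite lerD2l value_le_discounted.
Qed.

Lemma discounted_value_growth a : 0 <= a < 1 ->
  (1 - a) * discounted_value a z <= growth.
Proof.
move=> a01; have /andP[a0 a1] := a01.
rewrite mulrC -ler_pdivlMr ?subr_gt0 //; apply: discounted_value_le => n.
by rewrite ler_pdivlMr ?subr_gt0 // mulrC value_growth.
Qed.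

(** Half of the discounted optimality equation, from [bellman_liminf] applied to the finite-horizon
    values, whose horizon [bellman] raises from [k] to [k.+1]. *)
Lemma discounted_value_bellman a x : 0 <= a < 1 ->
  bellman p (fun y => a * discounted_value a y) x <= discounted_value a x.
Proof.
move=> a01; have /andP[a0 a1] := a01; apply/ler_addgt0Pr => e e0.
have : \forall k \near \oo, bellman p (fun y => a * discounted_value a y) x - e
    <= bellman p (fun y => a * value p a k y) x.
  apply: bellman_liminf => // l d.
  set y := next_ages _ _.
  have [_ [n _ <-] h] := sup_adherent e0 (discounted_value_has_sup y a01).
  exists n => // k /= nk; rewrite -/(discounted_value a y) in h.
  have := value_incr p01 y a0 nk => h'.
  have := ler_wpM2l a0 (ltW (lt_le_trans h h')); have : a * e <= e.
    by rewrite ler_piMl // ltW.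
  by rewrite mulrBr; lra.
move=> /filter_ex[k]; rewrite lerBlDr => /le_trans; apply; rewrite lerD2r.
exact: (value_le_discounted k.+1 x a01).
Qed.

Let disc (k : nat) : R := 1 - k.+1%:R^-1.

Lemma disc01 k : 0 <= disc k < 1.
Proof.
by rewrite subr_ge0 gtrBl invr_gt0 ltr0n invf_le1 ?ltr0n // ler1n.
Qed.

Let B := b z.

(** The truncation at [- B] keeps the sequence bounded below, and its lower limit meaningful, at all
    ages; it is inactive at dominating ones. *)
Let rel_value k x : R :=
  Num.max (- B) (discounted_value (disc k) x - discounted_value (disc k) z).

Definition relative_value x : R := lower_limit (fun k => rel_value k x).

(** The limit superior of (1 - a) V_a z, obtained by negation. *)
Definition average_value : R :=
  - lower_limit (fun k => - ((1 - disc k) * discounted_value (disc k) z)).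

Lemma rel_value_bounds k x : - B <= rel_value k x <= b x.
Proof.
rewrite le_max lexx /= ge_max; apply/andP; split.
  by apply: le_trans (bound_ge0 x); rewrite oppr_le0 bound_ge0.
by rewrite lerBlDr discounted_value_bound // disc01.
Qed.

(** A dominating [x] lies above some [r], so V_a x >= V_a r >= V_a z - b z. *)
Lemma rel_valueE k x : dominating x ->
  rel_value k x = discounted_value (disc k) x - discounted_value (disc k) z.
Proof.
move=> [r rB rx]; apply/max_idPr; rewrite lerBrDr addrC lerBlDr addrC.
apply: le_trans (discounted_value_bound z (disc01 k) rB) _.
by rewrite lerD2l discounted_value_mono ?disc01.
Qed.

Lemma relative_value_ge x : - B <= relative_value x.
Proof.
apply: le_lower_limit (rel_value_bounds ^~ x) _.
by apply: nearW => k; have /andP[] := rel_value_bounds k x.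
Qed.

Lemma relative_value_mono : monotone_ages relative_value.
Proof.
move=> x y xy; pose hi := Num.max (b x) (b y).
apply: (@lower_limit_mono _ _ _ (- B) hi) => k.
- by have /andP[-> h] := rel_value_bounds k x; rewrite le_max h.
- by have /andP[-> h] := rel_value_bounds k y; rewrite le_max h orbT.
- rewrite /rel_value ge_max !le_max lexx /= lerB ?orbT //.
  by rewrite discounted_value_mono ?disc01.
Qed.

Lemma average_bounds k :
  - growth <= - ((1 - disc k) * discounted_value (disc k) z) <= 0.
Proof.
rewrite lerN2 discounted_value_growth ?disc01 //= oppr_le0 mulr_ge0 //.
  by rewrite subr_ge0 ltW //; case/andP: (disc01 k).
by rewrite discounted_value_ge0 ?disc01.
Qed.

Lemma near_disc_small (c e : R) : 0 < e ->
  \forall k \near \oo, (1 - disc k) * c <= e.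
Proof.
move=> e0; apply: filterS (near_harmonic_small c e0) => k.
by rewrite /disc opprB addrC subrK.
Qed.

(** Subtracting a V_a z from the discounted inequality leaves L (u k) x <= V_a x - V_a z + (1 - a)
    V_a z, with a = [disc k]. Eventually the last term is at most g + e/2 and the left side at least
    L h x - e/2. *)
Lemma average_optimality x : dominating x ->
  bellman p relative_value x <= average_value + relative_value x.
Proof.
move=> xD; apply/ler_addgt0Pr => e e0; have e2 : 0 < e / 2 by rewrite divr_gt0.
have e4 : 0 < e / 2 / 2 by rewrite divr_gt0.
suff : bellman p relative_value x - average_value - e <= relative_value x by lra.
apply: le_lower_limit (rel_value_bounds ^~ x) _.
(* [u k y] falls short of V_a y - V_a z by at most (1 - a) b y, which vanishes in the limit. *)
pose u k y := disc k * discounted_value (disc k) y +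
  - (disc k * discounted_value (disc k) z).
have N1 : \forall k \near \oo,
    bellman p relative_value x - e / 2 <= bellman p (u k) x.
  apply: bellman_liminf => // l d; set y := next_ages _ _.
  have yD : dominating y by exact: dominating_next.
  have M1 := lower_limit_near (rel_value_bounds ^~ y) e4.
  have M2 := near_disc_small (b y) e4.
  apply: filterS2 M1 M2 => k; rewrite -/(relative_value y).
  have /andP[_] := rel_value_bounds k y; rewrite rel_valueE //.
  have /andP[_ d1] := disc01 k; have d1' : 0 <= 1 - disc k by rewrite subr_ge0 ltW.
  by move=> /(ler_wpM2l d1') h1 h2 h3; rewrite /u; lra.
have N2 := lower_limit_near average_bounds e2.
apply: filterS2 N1 N2 => k n1 n2; rewrite rel_valueE //.
have := bellman_addC p01 (u k) (disc k * discounted_value (disc k) z) x.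
have := discounted_value_bellman x (disc01 k).
set W := bellman p (fun y => _ + _) x; set W' := bellman p (fun y => _ * _) x.
have -> : W = W'.
  by apply: eq_bigr => l _; congr (_ * state_bellman _ _); apply/funext => y; rewrite subrK.
by move=> h1 h2; rewrite /average_value; lra.
Qed.

(* The Abelian half of the vanishing discount method: a bound M on the average
   cost of some policy gives the hypothesis below. *)
Lemma average_value_le (M K : R) (s : state N) : dominating s.1 ->
  (forall a n, 0 <= a < 1 ->
    state_bellman (fun y => a * value p a n y) s <= M / (1 - a) + K) ->
  average_value <= M.
Proof.
case: s => x l /= xD H; apply/ler_addgt0Pr => e e0.
rewrite /average_value lerNl; apply: le_lower_limit average_bounds _.
apply: filterS (near_disc_small (K + b z + growth) e0) => k hk.
rewrite lerN2; set a := disc k in hk *.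
have a01 : 0 <= a < 1 by exact: disc01.
have /andP[a0 a1] := a01; have b0 : 0 < 1 - a by rewrite subr_gt0.
have step n : a * value p a n z <= M / (1 - a) + K + b z.
  have := H a n a01; rewrite /state_bellman /action_value.
  set y := next_ages _ _ => h.
  have [r rB ry] : dominating y by exact: dominating_next.
  have a01' : 0 <= a <= 1 by rewrite a0 ltW.
  have := value_le_b n z a01' rB; have := value_mono p01 n a0 ry => h1 h2.
  have h3 : value p a n z <= b z + value p a n y by lra.
  have := ler_wpM2l a0 h3; rewrite mulrDr.
  have : a * b z <= b z by rewrite ler_piMl ?bound_ge0 // ltW.
  have := cost_ge0 R (x, l) (greedy (fun y => a * value p a n y) (x, l)).
  by lra.
have step' : a * discounted_value a z <= M / (1 - a) + K + b z.
  (* The factor [disc 0] is 0, by which one cannot divide. *)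
  have [az|an0] := eqVneq a 0.
    by have := step 0%N; rewrite /= mulr0 [in a * _]az mul0r.
  have ap : 0 < a by rewrite lt_neqAle eq_sym an0.
  rewrite mulrC -ler_pdivlMr //; apply: discounted_value_le => n.
  by rewrite ler_pdivlMr // mulrC step.
(* (1 - a) V_a z splits into (1 - a) a V_a z, bounded by [step'], and (1 - a) (1 - a) V_a z, at most
   (1 - a) growth. *)
have := ler_wpM2l (ltW b0) step'; have := ler_wpM2l (ltW b0) (discounted_value_growth a01).
have -> : (1 - a) * (M / (1 - a) + K + b z) = M + (1 - a) * (K + b z).
  by field; rewrite gt_eqF.
by move: hk; lra.
Qed.

End AverageOptimality.

(** * Expected costs of policies *)

Section Policies.
Variables (R : realType) (N : nat) (p : 'I_N -> R).
Hypothesis p01 : forall i, 0 <= p i <= 1.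
Implicit Types (pi : policy R N) (s : state N) (h : seq (state N * action N)).

(** Expected cost incurred [t] slots from now, given the past [h] and the present state [s]. Total
    costs split into these terms, which can be discounted separately. *)
Fixpoint slot_cost pi t h s : R :=
  \sum_(d : option 'I_N) policy_prob pi h s d *
    (if t is t'.+1 then
       \sum_(l : {ffun 'I_N -> bool}) arrival_prob p l *
         slot_cost pi t' (rcons h (s, d)) (next_ages s d, l)
     else cost R s d).

Lemma policy_prob_sum_const pi h s (c : R) :
  \sum_(d : option 'I_N) policy_prob pi h s d * c = c.
Proof. by rewrite -mulr_suml policy_prob_sum1 mul1r. Qed.

Lemma policy_sum_ge pi h s (c : R) (F : option 'I_N -> R) :
  (forall d, c <= F d) -> c <= \sum_d policy_prob pi h s d * F d.
Proof.
move=> cF; rewrite -[leLHS](policy_prob_sum_const pi h s).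
by apply: ler_sum => d _; rewrite ler_wpM2l ?policy_prob_ge0.
Qed.

Lemma slot_cost_ge0 pi t h s : 0 <= slot_cost pi t h s.
Proof.
elim: t h s => [|t IH] h s; apply: policy_sum_ge => d; first exact: cost_ge0.
by apply: sumr_ge0 => l _; rewrite mulr_ge0 ?arrival_prob_ge0.
Qed.

Lemma sum_tuple_cons (T : finType) n (F : n.+1.-tuple T -> R) :
  \sum_w F w = \sum_t \sum_(w : n.-tuple T) F [tuple of t :: w].
Proof.
rewrite pair_big /=.
rewrite (reindex (fun tw : T * n.-tuple T => [tuple of tw.1 :: tw.2])) //=.
exists (fun w => (thead w, [tuple of behead w])) => [[t w] _|w _] /=.
  by rewrite theadE; congr (_, _); exact: val_inj.
by rewrite [RHS]tuple_eta; exact: val_inj.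
Qed.

Lemma path_sumS n (F : n.+1.-tuple (option 'I_N * {ffun 'I_N -> bool}) -> R) :
  \sum_w F w = \sum_d \sum_l \sum_(w : n.-tuple _) F [tuple of (d, l) :: w].
Proof. by rewrite sum_tuple_cons [RHS]pair_big /=; apply: eq_bigr => -[d l] _. Qed.

Lemma path_prob_sum pi n h s :
  \sum_(w : n.-tuple (option 'I_N * {ffun 'I_N -> bool})%type)
    path_prob p pi h s w = 1.
Proof.
elim: n h s => [|n IH] h s.
  rewrite (bigD1 [tuple]) //= big1 ?addr0 // => w /eqP; rewrite tuple0.
  by case.
rewrite path_sumS -[RHS](policy_prob_sum1 pi h s); apply: eq_bigr => d _.
rewrite -[RHS]mulr1 -(arrival_prob_sum p) mulr_sumr; apply: eq_bigr => l _.
by rewrite /= -mulr_sumr IH mulr1.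
Qed.

(** Condition on the first decision and the arrivals after it; the first cost keeps its weight
    because the probabilities of the continuations sum to 1. *)
Lemma path_cost_sum pi n h s :
  \sum_(w : n.-tuple (option 'I_N * {ffun 'I_N -> bool})%type)
    path_prob p pi h s w * path_cost R s w = \sum_(t < n) slot_cost pi t h s.
Proof.
elim: n h s => [|n IH] h s.
  by rewrite big_ord0 big1 // => w _; rewrite tuple0 /= mulr0.
rewrite path_sumS big_ord_recl.
under [X in _ = _ + X]eq_bigr do rewrite lift0 /=.
rewrite [X in _ = _ + X]exchange_big /= -big_split /=; apply: eq_bigr => d _.
rewrite -[in RHS]mulr_sumr -mulrDr [in RHS]exchange_big /=.
under [in RHS]eq_bigr do rewrite -mulr_sumr -IH.
rewrite -[X in _ = _ * (X + _)](arrival_sum_const p) -big_split /= mulr_sumr.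
apply: eq_bigr => l _; rewrite -mulrDr mulrA.
under eq_bigr do rewrite -mulrA.
rewrite -mulr_sumr; congr (_ * _).
under [LHS]eq_bigr do rewrite mulrDr.
by rewrite big_split -mulr_suml path_prob_sum mul1r.
Qed.

Lemma expected_total_costE pi s T :
  expected_total_cost p pi s T = \sum_(t < T.+1) slot_cost pi t [::] s.
Proof. exact: path_cost_sum. Qed.

Lemma discounted_slotS pi a n h s :
  \sum_(t < n.+1) a ^+ t * slot_cost pi t h s =
  \sum_d policy_prob pi h s d *
    (cost R s d + a * \sum_(l : {ffun 'I_N -> bool}) arrival_prob p l *
      \sum_(t < n) a ^+ t * slot_cost pi t (rcons h (s, d)) (next_ages s d, l)).
Proof.
rewrite big_ord_recl expr0 mul1r.
under [RHS]eq_bigr do rewrite mulrDr.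
rewrite big_split /=; congr (_ + _).
under [LHS]eq_bigr do rewrite /bump leq0n add1n add0n mulr_sumr.
rewrite [LHS]exchange_big /=; apply: eq_bigr => d _.
rewrite !mulr_sumr; under [LHS]eq_bigr do rewrite !mulr_sumr.
rewrite [LHS]exchange_big /=; apply: eq_bigr => l _; rewrite !mulr_sumr; apply: eq_bigr => t _.
by rewrite exprS; ring.
Qed.

(** A mean over randomized decisions is at least the least action value. Quantifying over [h] lets
    the induction cover history-dependent policies. *)
Lemma value_le_discounted_cost pi a n h s : 0 <= a ->
  state_bellman (fun y => a * value p a n y) s <=
  \sum_(t < n.+1) a ^+ t * slot_cost pi t h s.
Proof.
move=> a0; elim: n h s => [|n IH] h s; rewrite discounted_slotS;
    apply: policy_sum_ge => d; apply: le_trans (state_bellman_le _ _ d) _;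
    rewrite /action_value lerD2l ler_wpM2l //=.
  by apply: sumr_ge0 => l _; rewrite big_ord0 mulr0.
by apply: arrival_sum_le => // l; exact: IH.
Qed.

Lemma stationary_slotS pi f n k s : deterministic_stationary pi f ->
  \sum_(t < n.+1) slot_cost pi t k s =
  cost R s (f s) + \sum_(l : {ffun 'I_N -> bool}) arrival_prob p l *
    \sum_(t < n) slot_cost pi t (rcons k (s, f s)) (next_ages s (f s), l).
Proof.
(* The total cost is the discounted cost with factor 1, so [discounted_slotS] applies. *)
move=> pif; have E m h' s' : \sum_(t < m) slot_cost pi t h' s' =
    \sum_(t < m) 1 ^+ t * slot_cost pi t h' s'.
  by apply: eq_bigr => t _; rewrite expr1n mul1r.
rewrite E discounted_slotS (bigD1 (f s)) //= pif eqxx mul1r mul1r.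
rewrite [X in _ + X = _]big1 => [|d /negbTE df]; last by rewrite pif df mul0r.
by rewrite addr0; congr (_ + _); apply: eq_bigr => l _; rewrite E.
Qed.

(** Telescoping: cost plus next [h] is on average at most g + h, and the final [h] is at least
    [- B]. The first slot, whose arrivals are given, enters through [state_bellman], so g is charged
    only [n] times. *)
Lemma greedy_cost_le pi (h : ages N -> R) (g B : R) :
  deterministic_stationary pi (greedy h) -> (forall x, - B <= h x) ->
  (forall x, dominating x -> bellman p h x <= g + h x) ->
  forall n k s, dominating s.1 ->
  \sum_(t < n.+1) slot_cost pi t k s <= n%:R * g + (state_bellman h s + B).
Proof.
move=> pif hB hg; elim=> [|n IH] k s sD; rewrite (stationary_slotS _ _ _ pif).
  rewrite mul0r add0r [X in _ + X <= _]big1 => [|l _]; last by rewrite big_ord0 mulr0.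
  rewrite /state_bellman /action_value -[leRHS]addrA lerD2l.
  by have := hB (next_ages s (greedy h s)); lra.
have nD : dominating (next_ages s (greedy h s)).
  by case: s sD => x l; exact: dominating_next.
rewrite /state_bellman /action_value -[X in _ <= _ + X]addrA [leRHS]addrCA lerD2l.
have := hg _ nD; move: (next_ages _ _) nD => y yD gy.
apply: (@le_trans _ _ (n%:R * g + (bellman p h y + B))); last first.
  by rewrite -natr1; lra.
rewrite /bellman -[n%:R * g](arrival_sum_const p) -[B](arrival_sum_const p).
rewrite -!big_split /=.
under [leRHS]eq_bigr do rewrite -!mulrDr.
by apply: arrival_sum_le => // l; exact: IH.
Qed.

End Policies.

(** * Abel summation *)

Section AbelSummation.
Variable R : realType.
Implicit Types (c : nat -> R) (a M K : R).

Lemma abel_sum_le c M K a n : 0 <= a < 1 -> 0 <= M ->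
  (forall m, \sum_(t < m) c t <= m%:R * M + K) ->
  \sum_(t < n) a ^+ t * c t <= M / (1 - a) + K.
Proof.
move=> /andP[a0 a1] M0 H; have b0 : 0 < 1 - a by rewrite subr_gt0.
have aX m : 0 <= a ^+ m <= 1 by rewrite exprn_ge0 // exprn_ile1 // ltW.
(* Summation by parts as an invariant; passing to m+1 adds the slack a^m (1 - a) ((m+1) M + K - S)
   >= 0. *)
have partial m : \sum_(t < m) a ^+ t * c t <= M * ((1 - a ^+ m) / (1 - a)) +
    a ^+ m * (\sum_(t < m) c t - m%:R * M) + (1 - a ^+ m) * K.
  elim: m => [|m IH]; first by rewrite !big_ord0 expr0 subrr; lra.
  rewrite big_ord_recr /=; set S := \sum_(t < m.+1) c t.
  have SE : \sum_(t < m) c t = S - c m by rewrite /S big_ord_recr /= addrK.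
  rewrite SE in IH.
  have := aX m.+1; have /andP[am0 _] := aX m.
  have SK : 0 <= a ^+ m * (1 - a) * (m.+1%:R * M + K - S).
    by rewrite !mulr_ge0 ?(ltW b0) // subr_ge0 H.
  move=> _; rewrite -(natr1 m) in SK *.
  have -> : (1 - a ^+ m.+1) / (1 - a) = (1 - a ^+ m) / (1 - a) + a ^+ m.
    by rewrite exprS; field; rewrite gt_eqF.
  by rewrite exprS; lra.
have /andP[an0 an1] := aX n.
apply: le_trans (partial n) _.
have h1 : a ^+ n * (\sum_(t < n) c t - n%:R * M) <= a ^+ n * K.
  by rewrite ler_wpM2l // lerBlDr addrC.
have h2 : M * ((1 - a ^+ n) / (1 - a)) <= M / (1 - a).
  rewrite ler_wpM2l // -[leRHS]mul1r ler_wpM2r ?invr_ge0 ?(ltW b0) //.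
  by rewrite gerBl.
lra.
Qed.

End AbelSummation.

(** * Long-run average costs *)

Section AverageCost.
Variables (R : realType) (N : nat) (p : 'I_N -> R).
Hypothesis p01 : forall i, 0 <= p i <= 1.
Implicit Types (pi : policy R N) (s : state N) (h : seq (state N * action N)).
Local Open Scope classical_set_scope.

Lemma average_costE pi s : average_cost p pi s = ereal_inf (range (esups
  (fun T => (T.+1%:R^-1 * \sum_(t < T.+1) slot_cost p pi t [::] s)%:E))).
Proof.
rewrite /average_cost.
under eq_fun do rewrite expected_total_costE.
by rewrite limn_esup_lim; apply/cvg_lim => //; exact: cvg_esups_inf.
Qed.

(** The averages are eventually at most [M], and [K] pays for the slots before that. *)
Lemma average_cost_ltP pi s M : (average_cost p pi s < M%:E)%E ->
  0 <= M /\ exists K, forall n, \sum_(t < n) slot_cost p pi t [::] s <= n%:R * M + K.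
Proof.
rewrite average_costE => /ereal_inf_lt[_ [n _ <-]] nM.
have bd T : (n <= T)%N -> \sum_(t < T.+1) slot_cost p pi t [::] s <= T.+1%:R * M.
  move=> nT; rewrite mulrC -ler_pdivrMr ?ltr0n // mulrC -lee_fin.
  by apply: le_trans (ltW nM); apply: ereal_sup_ubound; exists T.
have M0 : 0 <= M.
  have : 0 <= n.+1%:R * M.
    by apply: le_trans (bd n _) => //; apply: sumr_ge0 => t _; exact: slot_cost_ge0.
  by rewrite pmulr_rge0 // ltr0n.
split=> //; exists (\sum_(t < n) slot_cost p pi t [::] s) => m.
have K0 k : 0 <= \sum_(t < k) slot_cost p pi t [::] s.
  by apply: sumr_ge0 => t _; exact: slot_cost_ge0.
have [mn|] := leqP m n; last first.
  by case: m => // m nm; apply: le_trans (bd _ nm) _; rewrite lerDl.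
apply: ler_wpDl; first by rewrite mulr_ge0 ?ler0n.
rewrite -(subnKC mn) big_split_ord /= lerDl.
by apply: sumr_ge0 => t _; exact: slot_cost_ge0.
Qed.

Lemma average_cost_le pi s (g K : R) :
  (forall n, \sum_(t < n.+1) slot_cost p pi t [::] s <= n%:R * g + K) ->
  (average_cost p pi s <= g%:E)%E.
Proof.
move=> H; apply/lee_addgt0Pr => e e0; rewrite average_costE.
have [n _ nP] := near_harmonic_small (K - g) e0.
apply: le_trans (_ : _ <= esups _ n)%E _; first by apply: ereal_inf_lbound; exists n.
apply: ge_ereal_sup => _ [T /= nT <-]; rewrite -EFinD lee_fin.
have T0 : 0 < T.+1%:R :> R by rewrite ltr0n.
have Ti : 0 <= T.+1%:R^-1 :> R by rewrite invr_ge0 ltW.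
apply: le_trans (ler_wpM2l Ti (H T)) _.
have := nP T nT; have -> : T.+1%:R^-1 * (T%:R * g + K) = g + T.+1%:R^-1 * (K - g).
  by rewrite -natr1; field; rewrite natr1 gt_eqF.
by rewrite lerD2l.
Qed.

Lemma ereal_lt_between (x y : \bar R) : (x < y)%E ->
  exists M : R, (x < M%:E)%E /\ (M%:E < y)%E.
Proof.
case: x y => [x| |] [y| |] // xy; rewrite ?lte_fin in xy.
- by exists ((x + y) / 2); rewrite !lte_fin; split; lra.
- by exists (x + 1); rewrite lte_fin ltry; split=> //; lra.
- by exists (y - 1); rewrite lte_fin ltNyr; split=> //; lra.
- by exists 0; rewrite ltNyr ltry.
Qed.

(** User [i] is almost surely never served, so its age grows in every slot; it remains in the cost
    in full, as any reduction comes from another user. *)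
Lemma slot_cost_no_arrival pi (i : 'I_N) t h s : p i = 0 -> ~~ s.2 i ->
  (s.1 i + t)%:R <= slot_cost p pi t h s.
Proof.
move=> pi0; elim: t h s => [|t IH] h [x l] /= li; apply: policy_sum_ge => d.
  rewrite addn0 costE /= /age_sum (bigD1 i) //=.
  have s0 P : 0 <= \sum_(j < N | P j) (x j)%:R :> R.
    by apply: sumr_ge0 => j _; exact: ler0n.
  have N0 : 0 <= N%:R :> R by exact: ler0n.
  case: d => [j|]; last by have := s0 (fun j => j != i); lra.
  case lj : (l j); last first.
    by rewrite muln0 mulr0n; have := s0 (fun j => j != i); lra.
  have ji : j != i by apply: contraNneq li => <-; rewrite lj.
  rewrite (bigD1 j) //= muln1; have := s0 (fun k => (k != i) && (k != j)); lra.
rewrite -[leLHS](arrival_sum_const p); apply: ler_sum => l' _.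
have [l'i|l'i] := boolP (l' i).
  by rewrite arrival_probE (bigD1 i) //= l'i pi0 !mul0r.
rewrite ler_wpM2l ?arrival_prob_ge0 //.
apply: le_trans (IH _ (next_ages (x, l) d, l') l'i).
rewrite ler_nat /= next_agesE.
case: d => [j|]; last by rewrite ffunE addn1 addnS.
case lj : (l j); last by rewrite ffunE addn1 addnS.
rewrite ffunE; case: eqP => [ij|_]; last by rewrite addnS.
by rewrite ij lj in li.
Qed.

Lemma average_cost_no_arrival pi (i : 'I_N) s : p i = 0 ->
  average_cost p pi s = +oo%E.
Proof.
move=> pi0; apply/eqP; rewrite eq_le leey /= leNgt; apply/negP.
move=> /ereal_lt_between[M [/average_cost_ltP[M0 [K H]] _]].
(* The initial state may carry an arrival at [i] even though [p i = 0], so the growth is counted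
   from slot 1. *)
have slotS t : t%:R <= slot_cost p pi t.+1 [::] s.
  apply: policy_sum_ge => d.
  rewrite -[leLHS](arrival_sum_const p); apply: ler_sum => l _.
  have [li|li] := boolP (l i).
    by rewrite arrival_probE (bigD1 i) //= li pi0 !mul0r.
  rewrite ler_wpM2l ?arrival_prob_ge0 //.
  apply: le_trans (slot_cost_no_arrival pi t _ (s := (_, l)) pi0 li).
  by rewrite ler_nat leq_addl.
(* Slot costs eventually exceed M + 1; the term m (m+1) makes up for the cheaper early slots, and a
   large [n] contradicts the bound n M + K. *)
pose m := Num.bound `|M + 1|; have Mm : M + 1 < m%:R.
  by apply: le_lt_trans (ler_norm _) _; exact: archi_boundP.
have lb n : n%:R * m%:R - m%:R * m.+1%:R <= \sum_(t < n) slot_cost p pi t [::] s.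
  elim: n => [|n IH]; first by rewrite big_ord0 mul0r sub0r oppr_le0 mulr_ge0 ?ler0n.
  have [nm|mn] := leqP n m.
    apply: (@le_trans _ _ 0).
      by rewrite subr_le0 mulrC ler_wpM2l ?ler0n // ler_nat ltnS.
    by apply: sumr_ge0 => t _; exact: slot_cost_ge0.
  rewrite big_ord_recr /= -natr1 mulrDl mul1r addrAC lerD //.
  case: n mn {IH} => // n mn; apply: le_trans (slotS n).
  by rewrite ler_nat -ltnS.
pose n := Num.bound `|K + m%:R * m.+1%:R|.
have nK : K + m%:R * m.+1%:R < n%:R.
  by apply: le_lt_trans (ler_norm _) _; exact: archi_boundP.
have := le_trans (lb n) (H n); have n0 : 0 <= n%:R :> R by exact: ler0n.
have := ler_wpM2l n0 (ltW Mm); lra.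
Qed.

Definition stationary_prob (f : state N -> action N)
  (h : seq (state N * action N)) s (d : action N) : R := (d == f s)%:R.

Lemma stationary_prob_ge0 f h s d : 0 <= stationary_prob f h s d.
Proof. exact: ler0n. Qed.

Lemma stationary_prob_sum1 f h s :
  \sum_(d : option 'I_N) stationary_prob f h s d = 1.
Proof.
rewrite (bigD1 (f s)) //= big1 => [|d /negbTE df]; rewrite /stationary_prob.
  by rewrite eqxx addr0.
by rewrite df.
Qed.

Definition stationary_policy f : policy R N :=
  Policy (stationary_prob_ge0 f) (stationary_prob_sum1 f).

End AverageCost.

Theorem theorem8 (R : realType) (N : nat) (p : 'I_N -> R)
    (hp : forall i : 'I_N, 0 <= p i <= 1) :
  exists pi : policy R N, switch_type pi /\ Delta_optimal p pi.
Proof.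
have sw (u : ages N -> R) : monotone_ages u -> switch_type (stationary_policy R (greedy u)).
  by move=> um; exists (greedy u) => // i x l _; exact: greedy_switch.
have [[i pi0]|pN0] := pselect (exists i, p i = 0).
  exists (stationary_policy R (greedy (fun=> 0 : R))); split; first by apply: sw => x y _.
  by move=> s _ pi'; rewrite !(average_cost_no_arrival hp _ _ pi0).
have p0 i : 0 < p i.
  rewrite lt_neqAle eq_sym; have /andP[-> _] := hp i; rewrite andbT.
  by apply/eqP => pi0; apply: pN0; exists i.
have [b bP] := value_bounded hp p0.
set f := greedy (relative_value p b).
exists (stationary_policy R f); split.
  exact/sw/(relative_value_mono hp bP).
move=> s /dominating_state_space sD pi'.
apply: (@le_trans _ _ (average_value p)%:E).
  apply: average_cost_le => n; apply: greedy_cost_le => //.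
  - exact: relative_value_ge.
  - exact: average_optimality.
(* A better policy would leave room for a real [M] strictly below [average_value]; Abel summation
   turns its cost bound into the discounted one that forces [average_value] <= M. *)
rewrite leNgt; apply/negP => /ereal_lt_between[M [/(average_cost_ltP hp)[M0 [K H]]]].
rewrite lte_fin ltNge => /negP; apply.
apply: (average_value_le hp bP (K := K) sD) => a n a01.
have /andP[a0 _] := a01.
apply: le_trans (value_le_discounted_cost hp pi' n [::] s a0) _.
exact: (abel_sum_le (c := fun t => slot_cost p pi' t [::] s) _ a01 M0 H).
Qed.
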